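(* As formal power series in $t$, $$\sum_{\sigma \in S(321,3\bar{1}42)}y^{\mathrm{exc}(\sigma)}q^{\mathrm{cr}(\sigma)}t^{|\sigma|}=\cfrac{1}{1-t-\cfrac{yt^2}{1-qt-\cfrac{yqt^2}{1-q^2t-\cfrac{yq^2t^2}{\ddots}}}}.$$
   Context: $S_n$ is the set of permutations of $[n]=\{1,\dots,n\}$; $|\sigma|=n$ for $\sigma\in S_n$. $\sigma$ avoids $321$ if there are no $i<j<k$ with $\sigma(i)>\sigma(j)>\sigma(k)$. $\sigma$ avoids the barred pattern $3\bar{1}42$ if every occurrence of $231$ in $\sigma$ is part of an occurrence of $3142$; that is, whenever $i<j<k$ and $\sigma(k)<\sigma(i)<\sigma(j)$, there is $l$ with $i<l<j$ and $\sigma(l)<\sigma(k)$. $S(321,3\bar{1}42)$ is the set of all permutations of all lengths, including the empty permutation, avoiding both $321$ and $3\bar{1}42$. $\mathrm{exc}(\sigma)$ is the number of indices $i$ with $\sigma(i)>i$; $\mathrm{cr}(\sigma)$ is the number of pairs $(i,j)$ with $i<j<\sigma(i)<\sigma(j)$ or $\sigma(i)<\sigma(j)\le i<j$. The infinite continued fraction is the limit of its finite truncations as formal power series in $t$ with polynomial coefficients in $y,q$; the denominator at level $k\ge 0$ begins with $1-q^kt$ and the partial numerator between level $k$ and level $k+1$ is $yq^kt^2$. *)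

(* Defs.v *)
From HB Require Import structures.
From mathcomp Require Import all_boot all_order all_algebra all_fingroup.
From mathcomp Require Import boolp zify.

Set Implicit Arguments.
Unset Strict Implicit.
Unset Printing Implicit Defensive.

Import GRing.Theory.

(* A permutation of {1, ..., n} is an element of 'S_n, i.e. a permutation of
   {0, ..., n-1}; the notions below only compare positions and values, so they
   are insensitive to this shift.  'S_0 contains only the empty permutation. *)

Definition avoids321 n (s : 'S_n) : bool :=
  ~~ [exists i : 'I_n, exists j : 'I_n, exists k : 'I_n,
        [&& i < j, j < k, s j < s i & s k < s j]].

(* The barred pattern 3(bar 1)42. *)
Definition avoids3b142 n (s : 'S_n) : bool :=
  [forall i : 'I_n, forall j : 'I_n, forall k : 'I_n,
     [&& i < j, j < k, s k < s i & s i < s j] ==>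
     [exists l : 'I_n, [&& i < l, l < j & s l < s k]]].

Definition exc n (s : 'S_n) : nat := #|[set i : 'I_n | i < s i]|.

Definition cr n (s : 'S_n) : nat :=
  #|[set ij : 'I_n * 'I_n | let: (i, j) := ij in
       [&& i < j, j < s i & s i < s j]
       || [&& s i < s j, s j <= i & i < j]]|.

Local Open Scope ring_scope.

(* Formal power series; f n is the coefficient of t^n in f. *)
Record fps (R : Type) := Fps { fps_coef :> nat -> R }.

Lemma fpsP (R : Type) (f g : fps R) : (forall n, f n = g n) -> f = g.
Proof. by case: f g => [f] [g] /= /funext ->. Qed.

HB.instance Definition _ (R : Type) := gen_eqMixin (fps R).
HB.instance Definition _ (R : Type) := gen_choiceMixin (fps R).

Section FpsZmodule.
Variable R : zmodType.
Implicit Types f g h : fps R.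

Definition fps_zero : fps R := Fps (fun=> 0).
Definition fps_opp f : fps R := Fps (fun n => - f n).
Definition fps_add f g : fps R := Fps (fun n => f n + g n).

Lemma fps_addA : associative fps_add.
Proof. by move=> f g h; apply: fpsP => n /=; rewrite addrA. Qed.
Lemma fps_addC : commutative fps_add.
Proof. by move=> f g; apply: fpsP => n /=; rewrite addrC. Qed.
Lemma fps_add0 : left_id fps_zero fps_add.
Proof. by move=> f; apply: fpsP => n /=; rewrite add0r. Qed.
Lemma fps_addN : left_inverse fps_zero fps_opp fps_add.
Proof. by move=> f; apply: fpsP => n /=; rewrite addNr. Qed.

HB.instance Definition _ :=
  GRing.isZmodule.Build (fps R) fps_addA fps_addC fps_add0 fps_addN.

Lemma fps0E n : (0 : fps R) n = 0. Proof. by []. Qed.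
Lemma fpsNE f n : (- f) n = - f n. Proof. by []. Qed.
Lemma fpsDE f g n : (f + g) n = f n + g n. Proof. by []. Qed.

End FpsZmodule.

Section FpsRing.
Variable R : comNzRingType.
Implicit Types f g h : fps R.

Definition fpsC (c : R) : fps R := Fps (fun n => if n is 0 then c else 0).
Definition fpsX : fps R := Fps (fun n => (n == 1%N)%:R).
Definition fps_mul f g : fps R :=
  Fps (fun n => \sum_(i < n.+1) f i * g (n - i)%N).

Definition fps_trunc m f : {poly R} := \poly_(i < m) f i.

Lemma fps_mul_trunc m f g n : (n < m)%N ->
  fps_mul f g n = (fps_trunc m f * fps_trunc m g)`_n.
Proof.
move=> lt_nm; rewrite coefM /=; apply: eq_bigr => i _.
rewrite !coef_poly (leq_ltn_trans (leq_subr _ _) lt_nm).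
by rewrite (leq_ltn_trans (leq_ord i) lt_nm).
Qed.

Lemma fps_mulA : associative fps_mul.
Proof.
move=> f g h; apply: fpsP => n.
have truncE (u : fps R) i : (i < n.+1)%N -> u i = (fps_trunc n.+1 u)`_i.
  by move=> lt_in; rewrite coef_poly lt_in.
transitivity
    ((fps_trunc n.+1 f * (fps_trunc n.+1 g * fps_trunc n.+1 h))`_n).
  rewrite coefM /=; apply: eq_bigr => i _; rewrite -truncE //.
  by congr (_ * _); rewrite -fps_mul_trunc // ltnS leq_subr.
rewrite mulrA coefM /=; apply: eq_bigr => i _.
by rewrite -truncE ?ltnS ?leq_subr // -fps_mul_trunc.
Qed.

Lemma fps_mulC : commutative fps_mul.
Proof.
move=> f g; apply: fpsP => n.
by rewrite !(@fps_mul_trunc n.+1) // mulrC.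
Qed.

Lemma fps_mul1 : left_id (fpsC 1) fps_mul.
Proof.
move=> f; apply: fpsP => n /=.
rewrite big_ord_recl /= mul1r subn0 big1 ?addr0 // => i _.
by rewrite mul0r.
Qed.

Lemma fps_mulDl : left_distributive fps_mul +%R.
Proof.
move=> f g h; apply: fpsP => n /=.
by rewrite -big_split; apply: eq_bigr => i _; rewrite mulrDl.
Qed.

Lemma fps_oner_neq0 : fpsC 1 != 0.
Proof. by apply/eqP => /(congr1 (fun f => f 0)) /eqP; rewrite oner_eq0. Qed.

HB.instance Definition _ := GRing.Zmodule_isComNzRing.Build (fps R)
  fps_mulA fps_mulC fps_mul1 fps_mulDl fps_oner_neq0.

Lemma fps1E n : (1 : fps R) n = (n == 0)%:R. Proof. by case: n. Qed.
Lemma fpsME f g n : (f * g) n = \sum_(i < n.+1) f i * g (n - i)%N.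
Proof. by []. Qed.
Lemma fpsM0 f g : (f * g) 0 = f 0 * g 0.
Proof. by rewrite fpsME big_ord1. Qed.
Lemma fps_sumE (I : Type) (r : seq I) (P : pred I) (F : I -> fps R) n :
  (\sum_(i <- r | P i) F i) n = \sum_(i <- r | P i) F i n.
Proof. exact: (big_morph (fun f : fps R => f n) (fun _ _ => erefl) erefl). Qed.

Lemma fpsX_low f m n : f 0 = 0 -> (n < m)%N -> (f ^+ m) n = 0.
Proof.
move=> f0; elim: m n => // m IHm n lt_nm; rewrite exprS fpsME.
apply: big1 => -[[|i] /= lt_in] _; first by rewrite f0 mul0r.
rewrite IHm ?mulr0 //; lia.
Qed.

End FpsRing.

Section FpsUnitRing.
Variable R : comUnitRingType.
Implicit Types f g : fps R.

Definition fps_unit : pred (fps R) := fun f => f 0 \is a GRing.unit.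

(* With c = f(0)^-1, the inverse of f is c (1 + u + u^2 + ...), u = 1 - c f;
   since u(0) = 0, only the powers u^k with k <= n contribute to t^n.
   Off the units the inverse is the identity, as GRing requires. *)
Definition fps_inv f : fps R :=
  if fps_unit f then
    Fps (fun n =>
      (f 0)^-1 * (\sum_(k < n.+1) (1 - fpsC (f 0)^-1 * f) ^+ k) n)
  else f.

Lemma fpsCM (c : R) f n : (fpsC c * f) n = c * f n.
Proof.
rewrite fpsME big_ord_recl /= subn0 big1 ?addr0 // => i _.
by rewrite mul0r.
Qed.

Lemma fps_mulV : {in fps_unit, left_inverse 1 fps_inv *%R}.
Proof.
move=> f f_unit; have f0 : f 0 \is a GRing.unit := f_unit.
rewrite /fps_inv [fps_unit f]f0; set c := (f 0)^-1.
set u := 1 - fpsC c * f.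
have u0 : u 0 = 0 by rewrite fpsDE fpsNE fps1E fpsCM mulVr // subrr.
apply: fpsP => n.
have -> : (Fps (fun m => c * (\sum_(k < m.+1) u ^+ k) m) * f) n =
          (fpsC c * (\sum_(k < n.+1) u ^+ k) * f) n.
  rewrite !fpsME; apply: eq_bigr => i _; congr (_ * _).
  rewrite fpsCM /=; congr (_ * _).
  have le_in : (i <= n)%N by rewrite -ltnS.
  rewrite !fps_sumE -(big_mkord xpredT (fun k => (u ^+ k) i)).
  rewrite -(big_mkord xpredT (fun k => (u ^+ k) i)).
  rewrite [RHS](big_cat_nat (n := i.+1)) //=.
  rewrite [X in _ = _ + X]big_nat [X in _ = _ + X]big1 ?addr0 //.
  by move=> k /andP[lt_ik _]; exact: fpsX_low.
have -> : fpsC c * (\sum_(k < n.+1) u ^+ k) * f = 1 - u ^+ n.+1.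
  have -> : 1 - u ^+ n.+1 = (1 - u) * \sum_(k < n.+1) u ^+ k.
    by rewrite -opprB subrX1 -mulNr opprB.
  by rewrite /u subKr mulrAC.
by rewrite fpsDE fpsNE fpsX_low // subr0.
Qed.

Lemma fps_unitP f g : g * f = 1 -> fps_unit f.
Proof.
move=> gf1; have := fpsM0 g f; rewrite gf1 fps1E => gf01.
by apply/unitrP; exists (g 0); rewrite [f 0 * _]mulrC -gf01.
Qed.

Lemma fps_inv_out : {in [predC fps_unit], fps_inv =1 id}.
Proof. by move=> f /negPf f_nunit; rewrite /fps_inv ifF. Qed.

HB.instance Definition _ := GRing.ComNzRing_hasMulInverse.Build (fps R)
  fps_mulV fps_unitP fps_inv_out.

Lemma fps_unitE f : (f \is a GRing.unit) = (f 0 \is a GRing.unit).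
Proof. by []. Qed.

(* Convergence of a sequence of formal power series: each coefficient is
   eventually constant. *)
Definition fps_cvg (u : nat -> fps R) (f : fps R) : Prop :=
  forall n, exists M, forall m, (M <= m)%N -> u m n = f n.

(* contfrac b a k m is the finite continued fraction
     1 / (b_k - a_k / (b_(k+1) - a_(k+1) / ( ... / b_(k+m)))). *)
Fixpoint contfrac (b a : nat -> fps R) (k m : nat) : fps R :=
  if m is m'.+1 then (b k - a k * contfrac b a k.+1 m')^-1 else (b k)^-1.

(* So, under these hypotheses, contfrac never inverts a non-unit. *)
Lemma contfrac_unit (b a : nat -> fps R) k m :
    (forall i, b i 0 = 1) -> (forall i, a i 0 = 0) ->
  b k - a k * contfrac b a k.+1 m \is a GRing.unit.
Proof.
move=> b0 a0; rewrite fps_unitE fpsDE fpsNE fpsM0 b0 a0 mul0r subr0.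
exact: unitr1.
Qed.

End FpsUnitRing.

(* Z[y, q], as polynomials in y with coefficients in Z[q]. *)
Definition Zyq : comUnitRingType := {poly {poly int}}.
Definition y : Zyq := 'X.
Definition q : Zyq := ('X)%:P.
Definition t : fps Zyq := fpsX Zyq.

Definition gf_321_3b142 : fps Zyq :=
  Fps (fun n => \sum_(s : 'S_n | avoids321 s && avoids3b142 s)
                  y ^+ exc s * q ^+ cr s).

(* Main.v *)
Require Import Defs.
From mathcomp Require Import all_boot all_order all_algebra all_fingroup.
From mathcomp Require Import zify ring.

Set Implicit Arguments.
Unset Strict Implicit.
Unset Printing Implicit Defensive.

Import GRing.Theory.

(* A permutation avoids 321 iff it increases on its excedances and on the other
   indices; it then avoids the barred pattern iff no two excedance positions
   are adjacent, and cr counts the pairs (i, k) with i < k < s(i).  It is thus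
   determined by the word recording, for each k, whether k is an excedance
   position and whether k is an excedance value, and the words that occur
   are those of a bicoloured Motzkin path without two consecutive excedance
   positions.  The generating series A_h of the suffixes of such words from
   height h (B_h if the previous index is an excedance position) satisfy a
   linear recursion.  With F_k the continued fraction from level k on, it is
   solved by
     A_h = q^(h(h-1)/2) t^h F_0 ... F_h E(h, h),
     B_h = q^(h(h-1)/2) t^h F_0 ... F_h E(h, h - 1),
   where E(h, 0) = 1 and E(h, m + 1) = E(h, m) + q^m y t F_(h+1) E(h + 1, m);
   in particular A_0 = F_0. *)

(** * Permutations that increase on a set and on its complement *)

Section Place.
Variable n : nat.
Implicit Types (A B : {set 'I_n}) (i j : 'I_n).

Let ltI : rel 'I_n := fun i j => i < j.

Let ltI_trans : transitive ltI.
Proof. by move=> j i k; apply: ltn_trans. Qed.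

Let sorted_enum A : sorted ltI (enum A).
Proof.
rewrite /enum_mem -enumT; apply: sorted_filter => //.
have := iota_ltn_sorted 0 n; rewrite -val_enum_ord sorted_map.
by apply: sub_sorted.
Qed.

Definition listing A := enum A ++ enum (~: A).

Lemma listing_uniq A : uniq (listing A).
Proof.
rewrite cat_uniq !enum_uniq andbT /=; apply/hasPn => i.
by rewrite !mem_enum inE.
Qed.

Lemma mem_listing A i : i \in listing A.
Proof. by rewrite mem_cat !mem_enum inE orbN. Qed.

Lemma size_listing A : size (listing A) = n.
Proof. by rewrite size_cat -!cardE cardsC card_ord. Qed.

(** When A and B have the same size, this is the map increasing from A onto B and from [~: A] onto
    [~: B]. Ranks in the concatenated listings make it injective for all A and B, so that
    [word_perm] is defined on every word. *)
Definition place A B i := nth i (listing B) (index i (listing A)).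

Lemma place_inj A B : injective (place A B).
Proof.
have lt_idx i : index i (listing A) < n.
  by rewrite -[X in _ < X](size_listing A) index_mem mem_listing.
move=> i j; rewrite /place (set_nth_default j) ?size_listing //.
move/eqP; rewrite nth_uniq ?size_listing ?listing_uniq // => /eqP eq_ij.
exact: (@index_inj _ i _ i j (mem_listing A i) (mem_listing A j)).
Qed.

Lemma map_place A B : map (place A B) (listing A) = listing B.
Proof.
case LA: (listing A) => [|i0 l].
  by apply/esym/size0nil; rewrite size_listing -(size_listing A) LA.
rewrite -LA; apply: (@eq_from_nth _ i0); rewrite size_map ?size_listing //.
move=> k lt_kn; rewrite (nth_map i0) ?size_listing // /place.
rewrite index_uniq ?size_listing ?listing_uniq //.
by apply: set_nth_default; rewrite size_listing.
Qed.

Lemma map_place_set A B : #|A| = #|B| ->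
  map (place A B) (enum A) = enum B /\
  map (place A B) (enum (~: A)) = enum (~: B).
Proof.
move=> eqAB; have /eqP := map_place A B.
by rewrite map_cat eqseq_cat ?size_map -?cardE // => /andP[/eqP ? /eqP].
Qed.

Lemma sorted_map_enum_lt (f : 'I_n -> 'I_n) A B i j :
  map f (enum A) = enum B -> i \in A -> j \in A -> i < j -> f i < f j.
Proof.
move=> fA iA jA lt_ij; have idx_lt : index i (enum A) < index j (enum A).
  case: (ltngtP (index i (enum A)) (index j (enum A))) => // [lt_ji|eq_ij].
    have := sorted_ltn_index ltI_trans (sorted_enum A).
    move=> /(_ j i); rewrite !mem_enum => /(_ jA iA lt_ji) /(ltn_trans lt_ij).
    by rewrite ltnn.
  move: lt_ij; rewrite (@index_inj _ i (enum A) i j _ _ eq_ij) ?mem_enum //.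
  by rewrite ltnn.
have := sorted_ltn_nth ltI_trans (f i) (sorted_enum B).
move=> /(_ (index i (enum A)) (index j (enum A))).
rewrite !inE -fA size_map !index_mem !mem_enum iA jA => /(_ isT isT idx_lt).
by rewrite !(nth_map i) ?index_mem ?mem_enum // !nth_index ?mem_enum.
Qed.

Lemma homo_map_enum (s : 'S_n) A :
  {in A &, forall i j, i < j -> s i < s j} ->
  map s (enum A) = enum [set s i | i in A].
Proof.
move=> sA; apply: (irr_sorted_eq ltI_trans) => //.
    by move=> i; rewrite /ltI ltnn.
  apply: (homo_sorted_in (P := [in A]) _ _ (sorted_enum A)) => //.
  by apply/allP => i; rewrite mem_enum.
move=> j; rewrite mem_enum; apply/mapP/imsetP => -[i iA ->]; exists i => //.
  by rewrite mem_enum in iA.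
by rewrite mem_enum.
Qed.

Lemma placeK (s : 'S_n) A :
    {in A &, forall i j, i < j -> s i < s j} ->
    {in ~: A &, forall i j, i < j -> s i < s j} ->
  place A [set s i | i in A] =1 s.
Proof.
move=> sA sCA i; rewrite /place.
have sCE : ~: [set s i | i in A] = [set s i | i in ~: A].
  apply/setP => j; rewrite inE -(permKV s j).
  by rewrite !mem_imset ?inE //; exact: perm_inj.
have -> : listing [set s i | i in A] = map s (listing A).
  by rewrite /listing map_cat sCE !homo_map_enum.
by rewrite (nth_map i) ?index_mem ?mem_listing // nth_index ?mem_listing.
Qed.

End Place.

(** * Pattern avoidance and crossings in terms of the excedance set *)

Definition increasing_on n (A : {set 'I_n}) (s : 'S_n) :=
  {in A &, forall i j : 'I_n, i < j -> s i < s j}.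

Definition exc_set n (s : 'S_n) : {set 'I_n} := [set i : 'I_n | i < s i].

Definition sparse n (A : {set 'I_n}) :=
  forall i j : 'I_n, j = i.+1 :> nat -> i \in A -> j \notin A.

Section Class.
Variables (n : nat) (s : 'S_n).
Implicit Types i j k : 'I_n.

Let E := exc_set s.

Lemma card_perm_preim (p : pred 'I_n) : #|[set i | p (s i)]| = #|[set i | p i]|.
Proof.
rewrite -(card_imset [set i | p (s i)] (@perm_inj _ s)); congr #|pred_of_set _|.
apply/setP => j; rewrite -(permKV s j) mem_imset ?inE //; exact: perm_inj.
Qed.

(** As many positions as values are at most c; removing from both the i with i <= c and s i <= c
    leaves the two sides. *)
Lemma card_cut (c : nat) :
  #|[set i : 'I_n | (i <= c) && (c < s i)]|
  = #|[set i : 'I_n | (s i <= c) && (c < i)]|.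
Proof.
have := card_perm_preim (fun i : 'I_n => i <= c).
set S := [set i | s i <= c]; set L := [set i : 'I_n | i <= c] => cardSL.
have := cardsID L S; have := cardsID S L.
rewrite cardSL setIC => <- /addnI cutE.
transitivity #|L :\: S|; [|rewrite -cutE]; apply: eq_card => i.
all: by rewrite !inE -ltnNge andbC.
Qed.

Lemma ex_below i c : i <= c -> c < s i -> exists2 j : 'I_n, s j <= c & c < j.
Proof.
move=> le_ic lt_cs; have : 0 < #|[set i : 'I_n | (s i <= c) && (c < i)]|.
  by rewrite -card_cut; apply/card_gt0P; exists i; rewrite inE le_ic.
by case/card_gt0P => j; rewrite inE => /andP[]; exists j.
Qed.

Lemma ex_above i c : s i <= c -> c < i -> exists2 j : 'I_n, j <= c & c < s j.
Proof.
move=> le_sc lt_ci; have : 0 < #|[set i : 'I_n | (i <= c) && (c < s i)]|.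
  by rewrite card_cut; apply/card_gt0P; exists i; rewrite inE le_sc.
by case/card_gt0P => j; rewrite inE => /andP[]; exists j.
Qed.

Lemma avoids321P : reflect
  (forall i j k, i < j -> j < k -> s j < s i -> s k < s j -> False)
  (avoids321 s).
Proof.
apply: (iffP idP) => [/existsPn av i j k ij jk ji kj|av].
  have /existsPn/(_ j)/existsPn/(_ k) := av i.
  by rewrite ij jk ji kj.
apply/existsPn => i; apply/existsPn => j; apply/existsPn => k.
by apply/negP => /and4P[ij jk ji kj]; apply: (av i j k).
Qed.

Lemma neq_lt_perm i j : i < j -> s j < s i \/ s i < s j.
Proof.
move=> lt_ij; case: (ltngtP (s i) (s j)) => [||/val_inj/perm_inj eq_ij]; auto.
by rewrite eq_ij ltnn in lt_ij.
Qed.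

(** A descent between two excedances i < j extends to a 321 on the right, since the cut after j is
    also crossed downwards; one between two other indices extends on the left, by the cut after s
    i. *)
Lemma avoids321_increasing :
  avoids321 s -> increasing_on E s /\ increasing_on (~: E) s.
Proof.
move/avoids321P=> av; split=> i j; rewrite !inE -?leqNgt => Ei Ej lt_ij.
  case: (neq_lt_perm lt_ij) => // lt_ji.
  have [k skj lt_jk] := ex_below (leqnn j) Ej.
  by case: (av i j k) => //; exact: leq_ltn_trans skj Ej.
case: (neq_lt_perm lt_ij) => // lt_ji.
have [k le_ksi lt_sik] := ex_above (ltnW lt_ji) (leq_ltn_trans Ei lt_ij).
case: (av k i j) => //; rewrite ltn_neqAle (leq_trans le_ksi Ei) andbT.
by apply/eqP => /val_inj eq_ki; rewrite eq_ki ltnn in lt_sik.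
Qed.

(** If i in A had s i <= i, all elements of A up to i would have values at most i, one too many for
    the bound at i. If i outside A had s i > i, fewer indices outside A would have values at most i
    than positions at most i, so A would have to supply the surplus, again against the bound. *)
Lemma exc_setE (A : {set 'I_n}) :
    increasing_on A s -> increasing_on (~: A) s ->
    (forall k : 'I_n, #|[set i : 'I_n | (s i <= k) && (i \in A)]|
      <= #|[set i : 'I_n | (i < k) && (i \in A)]|) ->
  exc_set s = A.
Proof.
move=> incA incC cardA.
apply/setP => i; rewrite in_set; have := cardA i.
have [Ai|Ai'] := boolP (i \in A) => le_card.
  rewrite ltnNge; apply/negP => le_si.
  move: le_card; apply/negP; rewrite -ltnNge.
  apply: (@leq_trans #|[set j : 'I_n | (j <= i) && (j \in A)]|).
    rewrite [X in _ < X](cardsD1 i) inE leqnn Ai add1n ltnS.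
    apply/subset_leq_card/subsetP => j; rewrite !in_set => /andP[lt_ji ->].
    by rewrite in_set1 (ltnW lt_ji) -val_eqE ltn_eqF.
  apply/subset_leq_card/subsetP => j; rewrite !in_set => /andP[le_ji Aj].
  rewrite Aj andbT; move: le_ji; rewrite leq_eqVlt.
  case/orP => [/eqP/val_inj-> //|lt_ji].
  by have := incA j i Aj Ai lt_ji; lia.
apply/negbTE; rewrite -leqNgt leqNgt; apply/negP => lt_is.
move: le_card; apply/negP; rewrite -ltnNge.
have := card_perm_preim (fun j => j <= i).
set L := [set j : 'I_n | j <= i]; set S := [set j | s j <= i] => eqSL.
have := cardsID A S; have := cardsID A L; rewrite -eqSL.
have : #|S :\: A| < #|L :\: A|.
  rewrite [X in _ < X](cardsD1 i) inE Ai' inE leqnn add1n ltnS.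
  apply/subset_leq_card/subsetP => j; rewrite !in_set => /andP[Aj' le_ji].
  rewrite Aj' in_set1; case: (ltngtP j i) => [lt_ji|lt_ij|/val_inj eq_ji].
  - by rewrite -val_eqE ltn_eqF.
  - have := incC i j; rewrite !in_setC => /(_ Ai' Aj' lt_ij); lia.
  - by rewrite eq_ji in le_ji; lia.
have -> : #|L :&: A| = #|[set j : 'I_n | (j < i) && (j \in A)]|.
  apply: eq_card => j; rewrite !in_set; case: (eqVneq j i) => [->|neq_ji].
    by rewrite (negbTE Ai') !andbF.
  by rewrite ltn_neqAle val_eqE neq_ji.
have -> : #|S :&: A| = #|[set j : 'I_n | (s j <= i) && (j \in A)]|.
  by apply: eq_card => j; rewrite !in_set.
by move=> lt1 e1 e2; rewrite -(ltn_add2r #|S :\: A|) e2 -e1 ltn_add2l.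
Qed.

Hypotheses (incE : increasing_on E s) (incC : increasing_on (~: E) s).

Lemma inversion_exc i j : i < j -> s j < s i -> i \in E /\ j \notin E.
Proof.
move=> lt_ij lt_ji; case Ei: (i \in E); case Ej: (j \in E) => //.
- by have := incE Ei Ej lt_ij; lia.
- by move: Ei Ej; rewrite !inE; lia.
- by have := incC _ _ lt_ij; rewrite !inE in Ei Ej *; rewrite Ei Ej; lia.
Qed.

Lemma increasing_avoids321 : avoids321 s.
Proof.
apply/avoids321P => i j k ij jk ji kj.
have [_ /negP jE] := inversion_exc ij ji.
by have [] := inversion_exc jk kj.
Qed.

(** Two adjacent excedances, with a later k whose value is at most the second position, form a 231
    whose first two entries leave no room for the barred entry. *)
Lemma avoids3b142_sparse : avoids3b142 s -> sparse E.
Proof.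
move=> av i j ij Ei; apply/negP => Ej.
have lt_ij : i < j by rewrite ij.
have sij := incE Ei Ej lt_ij; have := Ej; rewrite inE => Ej'.
have [k skj lt_jk] := ex_below (leqnn j) Ej'.
have ski : s k < s i.
  rewrite inE in Ei; rewrite ltn_neqAle (leq_trans skj) ?ij // andbT.
  by apply/eqP => /val_inj/perm_inj eq_ki; rewrite eq_ki in lt_jk; lia.
move/forallP/(_ i)/forallP/(_ j)/forallP/(_ k): av.
rewrite lt_ij lt_jk ski sij => /existsP[l]; lia.
Qed.

(** In a 231 at i < j < k, i and j are excedances and k is not. The barred entry is found at i + 1:
    by sparseness it is no excedance, hence lies before j and has a value below s k. *)
Lemma sparse_avoids3b142 : sparse E -> avoids3b142 s.
Proof.
move=> sp; apply/forallP => i; apply/forallP => j; apply/forallP => k.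
apply/implyP => /and4P[ij jk ki ji].
have [Ei Ek] := inversion_exc (ltn_trans ij jk) ki.
have [Ej _] := inversion_exc jk (ltn_trans ki ji).
have lt_in : i.+1 < n by have := ltn_ord j; lia.
pose l := Ordinal lt_in; have nEl := sp i l erefl Ei.
have lt_lj : l < j.
  rewrite ltn_neqAle ij andbT; apply/eqP => /val_inj lj.
  by rewrite lj Ej in nEl.
apply/existsP; exists l; rewrite ltnSn lt_lj /=.
by apply: incC (ltn_trans lt_lj jk); rewrite in_setC.
Qed.

(** A crossing of the first kind is charged to its second index, one of the second kind to its
    first. An excedance k receives only the first kind, any other k only the second, and
    monotonicity makes the comparison of values automatic. *)
Lemma card_crossings :
  cr s = \sum_(k < n) #|[set i : 'I_n | (i < k) && (k < s i)]|.
Proof.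
have set_sum (p : pred 'I_n) : #|[set i | p i]| = \sum_(i < n) p i.
  by rewrite cardsE -sum1_card big_mkcond.
pose A (i j : 'I_n) : bool := [&& i < j, j < s i & s i < s j].
pose B (i j : 'I_n) : bool := [&& s i < s j, s j <= i & i < j].
transitivity (\sum_(k < n) (\sum_(i < n) A i k + \sum_(j < n) B k j)).
  rewrite big_split /= [X in X + _]exchange_big !pair_bigA -big_split /=.
  rewrite /cr cardsE -sum1_card big_mkcond; apply: eq_bigr => -[i j] _ /=.
  have AB : A i j -> B i j = false by rewrite /A /B; lia.
  rewrite unfold_in -/(A i j) -/(B i j).
  by case: (A i j) AB => [->|_] //; case: (B i j).
apply: eq_bigr => k _; rewrite -!set_sum; case Ek: (k \in E).
  rewrite [X in _ + X](_ : _ = 0) ?addn0.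
    apply: eq_card => i; rewrite !inE /A.
    case lt_ik: (i < k); case lt_ks: (k < s i) => //=.
    by rewrite incE // inE; apply: ltn_trans lt_ks.
  by apply: eq_card0 => j; move: Ek; rewrite !inE /B; lia.
rewrite [X in X + _](_ : _ = 0) ?add0n; last first.
  by apply: eq_card0 => j; move: Ek; rewrite !inE /A; lia.
(* For k not an excedance, the downward crossings of the cut after k are traded for the upward ones;
   k itself is not among these. *)
transitivity #|[set j : 'I_n | (s j <= k) && (k < j)]|.
  apply: eq_card => j; rewrite !inE /B.
  case le_sk: (s j <= k); case lt_kj: (k < j); rewrite ?andbF //= andbT.
  by apply: incC => //; rewrite !inE in Ek *; lia.
rewrite -card_cut; apply: eq_card => i; move: Ek; rewrite !inE.
case: (eqVneq i k) => [->|] ; first by lia.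
by rewrite -val_eqE /=; lia.
Qed.

End Class.

(** * The linear recursion and its closed-form solution *)

Section SuffixSeries.
Local Open Scope ring_scope.
Variables (R : comNzRingType) (Q Y T : R) (F : nat -> R).
Hypothesis FE : forall k,
  F k = 1 + Q ^+ k * T * F k + Y * Q ^+ k * T ^+ 2 * F k.+1 * F k.

(* Closed form of [corr h m]: the sum over j <= m of
   qbinom(m, j) Q^(j(j-1)/2) (Y T)^j F_(h+1) ... F_(h+j). *)
Fixpoint corr (h m : nat) : R :=
  if m is m'.+1 then corr h m' + Q ^+ m' * Y * T * F h.+1 * corr h.+1 m'
  else 1.

Fixpoint descent (h : nat) : R :=
  if h is h'.+1 then Q ^+ h' * T * F h'.+1 * descent h' else F 0.

Definition free_series h := descent h * corr h h.
(** Just after an excedance position the height is positive, so [h.-1] is a true predecessor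
    wherever the series describes such a state. *)
Definition blocked_series h := descent h * corr h h.-1.

(** For m = 0 this is [FE] at level h + 1. The step combines the instances at h and h + 1, whose
    powers match because Q^m Q^(h+2) = Q^(m+1) Q^(h+1). *)
Lemma corr_shift h m :
  F h.+1 * corr h.+1 m = Q ^+ h.+1 * T * F h.+1 * corr h.+1 m.+1 + corr h m.
Proof.
elim: m h => [|m IHm] h.
  by rewrite /= {1}FE; ring.
have /= I1 := IHm h; have /= I2 := IHm h.+1.
transitivity (F h.+1 * corr h.+1 m
  + Q ^+ m * Y * T * F h.+1 * (F h.+2 * corr h.+2 m)).
  by rewrite /=; ring.
by rewrite I1 I2 /= !exprS; ring.
Qed.

(** This and the next two recursions split a suffix by its first letter; here that letter is no
    excedance position, and either is no excedance value (height kept) or is one (height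
    lowered). *)
Lemma blocked_seriesS h : blocked_series h.+1 =
  T * (Q ^+ h.+1 * free_series h.+1 + Q ^+ h * free_series h).
Proof.
rewrite /blocked_series /free_series /=.
transitivity (Q ^+ h * T * descent h * (F h.+1 * corr h.+1 h)); first by ring.
by rewrite corr_shift /= !exprS; ring.
Qed.

Lemma free_series0 :
  free_series 0 = 1 + T * (free_series 0 + Y * blocked_series 1).
Proof. by rewrite /free_series /blocked_series /= {1}FE; ring. Qed.

Lemma free_seriesS h : free_series h.+1 =
  T * (Q ^+ h.+1 * (free_series h.+1 + Y * blocked_series h.+2)
       + Q ^+ h * (free_series h + Y * blocked_series h.+1)).
Proof.
(* The defining recursion of [corr] at (h + 1, h + 1) splits off the blocked series; [corr_shift]
   turns the rest into two blocked series. *)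
transitivity (blocked_series h.+1 + Y * T *
    (Q ^+ h.+1 * blocked_series h.+2 + Q ^+ h * blocked_series h.+1)).
  rewrite /blocked_series /free_series [corr _ h.+1]/=.
  transitivity (descent h.+1 * corr h.+1 h
    + descent h.+1 * Q ^+ h * Y * T * (F h.+2 * corr h.+2 h)); first by ring.
  by rewrite corr_shift /= !exprS; ring.
by rewrite blocked_seriesS; ring.
Qed.

End SuffixSeries.

(** * Convergence of the continued fraction, coefficient by coefficient *)

Section Agreement.
Local Open Scope ring_scope.
Variable R : comUnitRingType.
Implicit Types f g : fps R.

Definition agree n f g := forall i, (i <= n)%N -> f i = g i.

Lemma agreeM n f f' g g' :
  agree n f f' -> agree n g g' -> agree n (f * g) (f' * g').
Proof.
move=> ff' gg' i le_in; rewrite !fpsME; apply: eq_bigr => j _.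
have lt_ji := ltn_ord j; rewrite ff' ?gg' //; lia.
Qed.

(** Both inverses have the form f^-1 u g^-1, with u = g and u = f respectively. *)
Lemma agreeV n f g : f \is a GRing.unit -> g \is a GRing.unit ->
  agree n f g -> agree n f^-1 g^-1.
Proof.
move=> uf ug fg i le_in.
have -> : f^-1 i = (f^-1 * g * g^-1) i by rewrite mulrK.
have -> : g^-1 i = (f^-1 * f * g^-1) i by rewrite mulVr ?mul1r.
apply: agreeM le_in => //; apply: agreeM => // j le_jn; rewrite fg //.
Qed.

Lemma fpsXM0 f : (fpsX R * f) 0%N = 0.
Proof. by rewrite fpsM0 mul0r. Qed.

Lemma fpsXMS f n : (fpsX R * f) n.+1 = f n.
Proof.
rewrite fpsME !big_ord_recl /= mul0r add0r mul1r subSS subn0.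
by rewrite big1 ?addr0 // => i _; rewrite mul0r.
Qed.

Lemma agreeX n f g : agree n f g -> agree n.+1 (fpsX R * f) (fpsX R * g).
Proof. by move=> fg [|i] le_in; rewrite ?fpsXM0 // !fpsXMS fg. Qed.

Variables b a : nat -> fps R.
Hypothesis b0 : forall k, b k 0%N = 1.
Hypothesis aX : forall k, exists c, a k = fpsX R * c.

Let a0 k : a k 0%N = 0.
Proof. by have [c ->] := aX k; rewrite fpsXM0. Qed.

(** The factor t in [a k] gains one coefficient per level, which drives the convergence. *)
Lemma agree_level n k f g : agree n f g ->
  agree n.+1 (b k - a k * f) (b k - a k * g).
Proof.
move=> fg i le_in; rewrite !fpsDE !fpsNE; have [c ->] := aX k.
by rewrite -!mulrA (@agreeX n _ (c * g)) //; apply: agreeM.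
Qed.

Lemma level_unit k f : b k - a k * f \is a GRing.unit.
Proof. by rewrite fps_unitE fpsDE fpsNE fpsM0 b0 a0 mul0r subr0 unitr1. Qed.

Lemma agree_contfrac n k m m' : (n <= m)%N -> (n <= m')%N ->
  agree n (contfrac b a k m) (contfrac b a k m').
Proof.
(* The bottom level is brought to the common form with tail 0. *)
have CE j l : exists f, contfrac b a j l = (b j - a j * f)^-1.
  case: l => [|l]; last by exists (contfrac b a j.+1 l).
  by exists 0; rewrite mulr0 subr0.
elim: n k m m' => [|n IHn] k m m'.
  have [f ->] := CE k m; have [f' ->] := CE k m' => _ _.
  apply: agreeV; rewrite ?level_unit // => -[] // _.
  by rewrite !fpsDE !fpsNE !fpsM0 a0 !mul0r.
case: m m' => [|m] [|m'] //= le_nm le_nm'.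
by apply: agreeV; rewrite ?level_unit //; apply/agree_level/IHn.
Qed.

Definition contfrac_lim k : fps R := Fps (fun n => contfrac b a k n n).

Lemma agree_contfrac_lim n k m : (n <= m)%N ->
  agree n (contfrac b a k m) (contfrac_lim k).
Proof.
move=> le_nm i le_in; rewrite /= (@agree_contfrac i k m i) //.
exact: leq_trans le_in le_nm.
Qed.

Lemma contfrac_cvg k : fps_cvg (contfrac b a k) (contfrac_lim k).
Proof. by move=> n; exists n => m /agree_contfrac_lim; apply. Qed.

Lemma contfrac_limE k :
  contfrac_lim k * (b k - a k * contfrac_lim k.+1) = 1.
Proof.
suff -> : contfrac_lim k = (b k - a k * contfrac_lim k.+1)^-1.
  by rewrite mulVr ?level_unit.
(* Depth n + 1 rather than n exposes the top level of the finite fraction. *)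
apply: fpsP => n; rewrite -(@agree_contfrac_lim n _ n.+1) //=.
apply: (@agreeV n.+1); rewrite ?level_unit //.
by apply/agree_level/agree_contfrac_lim.
Qed.

End Agreement.

(** * Generating series of weighted words *)

Section Words.
Local Open Scope ring_scope.

(* The letter of index k says whether k is an excedance position, and whether
   it is an excedance value, of a permutation sigma.  In the state before it, h
   is the number of i with i < k <= sigma(i) and s tells whether k - 1 is an
   excedance position; the exponent of q is the number of i with
   i < k < sigma(i). *)
Fixpoint word_weight (h : nat) (s : bool) (w : seq (bool * bool)) : Zyq :=
  if w is x :: w' then
    if (x.2 <= h)%N && ~~ (s && x.1) then
      q ^+ (h - x.2) * y ^+ x.1 * word_weight (h - x.2 + x.1) x.1 w'
    else 0
  else (h == 0%N)%:R.

Definition suffix_sum h s n : Zyq :=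
  \sum_(w : n.-tuple (bool * bool)) word_weight h s w.

Lemma big_tupleS (T : finType) (V : zmodType) n (F : seq T -> V) :
  \sum_(w : n.+1.-tuple T) F w = \sum_(x : T) \sum_(w : n.-tuple T) F (x :: w).
Proof.
rewrite pair_bigA /=.
rewrite (reindex (fun p : T * n.-tuple T => [tuple of p.1 :: p.2])) //=.
exists (fun w => (thead w, [tuple of behead w])) => [[x w]|w] _ /=.
  by congr pair; apply: val_inj.
by rewrite [RHS]tuple_eta; apply: val_inj.
Qed.

Lemma suffix_sum0 h s : suffix_sum h s 0 = (h == 0%N)%:R.
Proof.
rewrite /suffix_sum (big_pred1 [tuple]) // => w.
by symmetry; apply/eqP; exact: tuple0.
Qed.

Lemma suffix_sumS h s n : suffix_sum h s n.+1 =
  \sum_(v : bool) \sum_(p : bool) if (v <= h)%N && ~~ (s && p) then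
    q ^+ (h - v) * y ^+ p * suffix_sum (h - v + p) p n else 0.
Proof.
rewrite /suffix_sum big_tupleS [RHS]exchange_big pair_bigA.
apply: eq_bigr => -[p v] _ /=.
by case: ifP => _; rewrite ?big_distrr // big1.
Qed.

Let b k : fps Zyq := 1 - fpsC (q ^+ k) * t.
Let a k : fps Zyq := fpsC (y * q ^+ k) * t ^+ 2.

Let b0 k : b k 0%N = 1.
Proof. by rewrite fpsDE fpsNE fps1E fpsM0 mulr0 subr0. Qed.

Let aX k : exists c, a k = t * c.
Proof. by exists (t * fpsC (y * q ^+ k)); rewrite /a; ring. Qed.

Lemma fpsC_exp (R : comUnitRingType) (c : R) k : fpsC c ^+ k = fpsC (c ^+ k).
Proof.
elim: k => [|k IHk]; first by apply: fpsP => -[].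
rewrite !exprS IHk; apply: fpsP => n; rewrite fpsCM.
by case: n => //= n; rewrite mulr0.
Qed.

Lemma contfrac_lim_rec k : contfrac_lim b a k =
  1 + fpsC q ^+ k * t * contfrac_lim b a k
    + fpsC y * fpsC q ^+ k * t ^+ 2
        * contfrac_lim b a k.+1 * contfrac_lim b a k.
Proof.
have := contfrac_limE b0 aX k.
have -> : a k = fpsC y * fpsC q ^+ k * t ^+ 2.
  rewrite fpsC_exp /a; congr (_ * _); apply: fpsP => n; rewrite fpsCM.
  by case: n => //= n; rewrite mulr0.
have -> : b k = 1 - fpsC q ^+ k * t by rewrite fpsC_exp.
by move=> <-; ring.
Qed.

(** The factor t in the recursions makes coefficient n + 1 depend on coefficients n only, so both
    families are treated in one induction. *)
Lemma suffix_sum_series n :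
  (forall h, suffix_sum h false n =
     free_series (fpsC q) (fpsC y) t (contfrac_lim b a) h n) /\
  (forall h, suffix_sum h.+1 true n =
     blocked_series (fpsC q) (fpsC y) t (contfrac_lim b a) h.+1 n).
Proof.
have := free_series0 contfrac_lim_rec.
have := free_seriesS contfrac_lim_rec.
have := blocked_seriesS contfrac_lim_rec.
set A := free_series _ _ _ _; set B := blocked_series _ _ _ _.
(* The closed forms are forgotten; only their recursions are kept. *)
move: A B => A B BS AS A0.
elim: n => [|n [IHf IHb]].
  split=> [[|h]|h]; rewrite suffix_sum0.
  - by rewrite A0 fpsDE fps1E fpsXM0 addr0.
  - by rewrite AS fpsXM0.
  - by rewrite BS fpsXM0.
split=> [[|h]|h]; rewrite suffix_sumS !big_bool /=.
- rewrite A0 fpsDE fps1E fpsXMS fpsDE fpsCM -IHf -IHb.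
  by rewrite subn0 /=; ring.
- rewrite AS fpsXMS !fpsDE !fpsC_exp !fpsCM !fpsDE !fpsCM.
  by rewrite -!IHf -!IHb !subSS !subn0 !addn1 !addn0; ring.
- rewrite BS fpsXMS !fpsDE !fpsC_exp !fpsCM.
  by rewrite -!IHf !subSS !subn0 !addn0; ring.
Qed.

Lemma suffix_sum_cvg :
  fps_cvg (contfrac b a 0) (Fps (fun n => suffix_sum 0 false n)).
Proof.
have := contfrac_cvg b0 aX 0; congr fps_cvg; apply: fpsP => n /=.
by rewrite (suffix_sum_series n).1 /free_series mulr1.
Qed.

End Words.

(** * Words of nonzero weight, described by prefix counts *)

Fixpoint word_ok (h : nat) (b : bool) (w : seq (bool * bool)) : bool :=
  if w is x :: w' then
    [&& x.2 <= h, ~~ (b && x.1) & word_ok (h - x.2 + x.1) x.1 w']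
  else h == 0.

Notation npos k w := (count fst (take k w)).
Notation nval k w := (count snd (take k w)).

Lemma word_weightE h b w :
  word_weight h b w = (if word_ok h b w then
    y ^+ count fst w * q ^+ (\sum_(k < size w) (h + npos k w - nval k.+1 w))
  else 0)%R.
Proof.
elim: w h b => [|x w IHw] h b /=; first by rewrite big_ord0 mulr1; case: eqP.
rewrite andbA; case: ifP => //= /andP[le_xh _]; rewrite IHw.
case: ifP => _; last by rewrite mulr0.
rewrite big_ord_recl /= take0 !addn0 [in RHS]exprD.
rewrite [in RHS](eq_bigr
  (fun k : 'I_(size w) => h - x.2 + x.1 + npos k w - nval k.+1 w)).
  by rewrite exprD; ring.
by move=> k _; rewrite /= -[bump 0 k]/k.+1 add0n; lia.
Qed.

(** Prepending [b] shifts the position letters by one, so that index k of the longer list is the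
    predecessor of letter k. *)
Lemma word_okP h b w : reflect
  [/\ forall k, k < size w -> nval k.+1 w <= h + npos k w,
      forall k, k < size w ->
        nth false (b :: map fst w) k -> ~~ nth false (map fst w) k
    & h + count fst w = count snd w]
  (word_ok h b w).
Proof.
elim: w h b => [|x w IHw] h b /=.
  by rewrite !addn0; apply: (iffP eqP) => [->|[]].
apply: (iffP and3P) => [[le_xh bx /IHw[okv oks okt]]|[okv oks okt]].
  split=> [[|k] lt_k|[|k] lt_k|] /=.
  - by rewrite take0 /=; lia.
  - by have := okv k lt_k => /=; lia.
  - by move: bx; case: b.
  - exact: oks.
  - by lia.
have le_xh : x.2 <= h by have := okv 0 isT; rewrite take0 /=; lia.
split=> //; first by have /= := oks 0 isT; case: (b) => // ->.
apply/IHw; split=> [k lt_k|k lt_k|]; last by lia.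
  by have /= := okv k.+1 lt_k; lia.
exact: (oks k.+1).
Qed.

Lemma count_take_tuple (T : Type) n (a : pred T) (w : n.-tuple T) k :
  count a (take k w) = #|[set i : 'I_n | (i < k) && a (tnth w i)]|.
Proof.
elim: k => [|k IHk]; first by rewrite take0 eq_card0 // => i; rewrite inE.
case: (ltnP k n) => [lt_kn|le_nk]; last first.
  have -> : take k.+1 w = take k w by rewrite !take_oversize ?size_tuple ?leqW.
  rewrite IHk.
  by apply: eq_card => i; rewrite !inE !(leq_trans (ltn_ord i)) ?leqW.
pose k' := Ordinal lt_kn.
rewrite (take_nth (tnth w k')) ?size_tuple // -cats1 count_cat IHk /= addn0.
rewrite -[nth _ _ k]/(nth (tnth w k') w k') -tnth_nth [RHS](cardsD1 k') addnC.
rewrite inE ltnSn; congr (_ + _).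
apply: eq_card => i; rewrite !inE ltnS -val_eqE /=.
by case: (ltngtP i k).
Qed.

Lemma count_tuple (T : Type) n (a : pred T) (w : n.-tuple T) :
  count a w = #|[set i : 'I_n | a (tnth w i)]|.
Proof.
rewrite -[X in count a X](take_size w) count_take_tuple size_tuple.
by apply: eq_card => i; rewrite !inE ltn_ord.
Qed.

(** * The bijection between the class and the valid words *)

Section Encoding.
Variable n : nat.
Implicit Types (s : 'S_n) (w : n.-tuple (bool * bool)).

Definition excedance_word s : n.-tuple (bool * bool) :=
  [tuple (i < s i, (s^-1)%g i < i) | i < n].

Definition pos_set w := [set i | (tnth w i).1].
Definition val_set w := [set i | (tnth w i).2].

Lemma nth_pos_set w (i : 'I_n) : nth false (map fst w) i = (i \in pos_set w).
Proof.
rewrite inE (tnth_nth (false, false)).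
by rewrite (nth_map (false, false)) ?size_tuple.
Qed.

Lemma pos_set_word s : pos_set (excedance_word s) = exc_set s.
Proof. by apply/setP => i; rewrite !inE tnth_mktuple. Qed.

Lemma val_set_word s :
  val_set (excedance_word s) = [set s i | i in exc_set s].
Proof.
apply/setP => i; rewrite inE tnth_mktuple /=.
by rewrite -{3}(permKV s i) mem_imset ?inE ?permKV //; exact: perm_inj.
Qed.

Definition word_perm w : 'S_n :=
  perm (@place_inj n (pos_set w) (val_set w)).

Definition in_class s := avoids321 s && avoids3b142 s.

Lemma in_classP s : reflect
  [/\ increasing_on (exc_set s) s, increasing_on (~: exc_set s) s
    & sparse (exc_set s)]
  (in_class s).
Proof.
apply: (iffP andP) => [[av av']|[incE incC sp]].
  have [incE incC] := avoids321_increasing av.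
  by split=> //; apply: avoids3b142_sparse.
by split; [apply: increasing_avoids321 | apply: sparse_avoids3b142].
Qed.

Lemma excedance_wordK s : in_class s -> word_perm (excedance_word s) = s.
Proof.
case/in_classP => incE incC _; apply/permP => i.
by rewrite permE pos_set_word val_set_word placeK.
Qed.

Lemma npos_word s k :
  npos k (excedance_word s) = #|[set i : 'I_n | (i < k) && (i < s i)]|.
Proof.
rewrite count_take_tuple; apply: eq_card => i.
by rewrite !inE tnth_mktuple.
Qed.

Lemma nval_word s k :
  nval k (excedance_word s) = #|[set i : 'I_n | (s i < k) && (i < s i)]|.
Proof.
rewrite count_take_tuple.
have := card_perm_preim s (fun i => (i < k) && ((s^-1)%g i < i)).
under [X in #|pred_of_set X| = _]eq_finset => i do rewrite permK.
by move=> ->; apply: eq_card => i; rewrite !inE tnth_mktuple.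
Qed.

(** An excedance i < k either has its value at most k, and these give all excedance values up to k,
    or jumps over k. *)
Lemma word_height s k : npos k (excedance_word s) =
  nval k.+1 (excedance_word s) + #|[set i : 'I_n | (i < k) && (k < s i)]|.
Proof.
rewrite npos_word nval_word.
rewrite -(cardsID [set i : 'I_n | s i <= k]); congr (_ + _).
  by apply: eq_card => i; rewrite !inE ltnS; lia.
by apply: eq_card => i; rewrite !inE; lia.
Qed.

Lemma word_ok_excedance s : in_class s -> word_ok 0 false (excedance_word s).
Proof.
case/in_classP => incE incC sp; apply/word_okP; split=> [k _|k|].
- by rewrite word_height leq_addr.
- rewrite size_tuple => lt_kn; case: k lt_kn => // k lt_kn /=.
  have lt_kn' := ltnW lt_kn.
  have := sp (Ordinal lt_kn') (Ordinal lt_kn) erefl.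
  by rewrite -pos_set_word -!nth_pos_set.
- rewrite add0n -(take_size (excedance_word s)) npos_word nval_word size_tuple.
  by apply: eq_card => i; rewrite !inE !ltn_ord.
Qed.

Lemma word_weight_excedance s : in_class s ->
  word_weight 0 false (excedance_word s) = (y ^+ exc s * q ^+ cr s)%R.
Proof.
move=> cs; rewrite word_weightE word_ok_excedance //.
case/in_classP: cs => incE incC sp; congr (_ ^+ _ * _ ^+ _)%R.
  by rewrite count_tuple; apply: eq_card => i; rewrite !inE tnth_mktuple.
rewrite card_crossings // size_tuple; apply: eq_bigr => k _.
by rewrite add0n word_height addKn.
Qed.

(** The prefix condition of a valid word, started at height 0, is the counting hypothesis of
    [exc_setE]. *)
Lemma word_perm_ok w : word_ok 0 false w ->
  exc_set (word_perm w) = pos_set w /\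
  [/\ increasing_on (pos_set w) (word_perm w),
      increasing_on (~: pos_set w) (word_perm w),
      sparse (pos_set w) & [set word_perm w i | i in pos_set w] = val_set w].
Proof.
case/word_okP => okv oks okt; set s := word_perm w.
have [mapP mapC] : map s (enum (pos_set w)) = enum (val_set w) /\
    map s (enum (~: pos_set w)) = enum (~: val_set w).
  (* Ending at height 0 means as many excedance positions as excedance values. *)
  have [|e1 e2] := @map_place_set n (pos_set w) (val_set w).
    by move: okt; rewrite !count_tuple.
  by split; [rewrite -e1 | rewrite -e2]; apply: eq_map => i; rewrite permE.
have incP : increasing_on (pos_set w) s.
  by move=> i j Pi Pj; apply: (sorted_map_enum_lt mapP).
have incC : increasing_on (~: pos_set w) s.
  by move=> i j Pi Pj; apply: (sorted_map_enum_lt mapC).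
have sP i : (s i \in val_set w) = (i \in pos_set w).
  have [Pi|nPi] := boolP (i \in pos_set w).
    by rewrite -mem_enum -mapP map_f // mem_enum.
  apply/negbTE; rewrite -in_setC -mem_enum -mapC map_f // mem_enum.
  by rewrite in_setC.
have nposE k :
    npos k w = #|[set i : 'I_n | (i < k) && (i \in pos_set w)]|.
  by rewrite count_take_tuple; apply: eq_card => i; rewrite !inE.
have nvalE k :
    nval k.+1 w = #|[set i : 'I_n | (s i <= k) && (i \in pos_set w)]|.
  pose p (i : 'I_n) := (i <= k) && (i \in val_set w).
  rewrite count_take_tuple; transitivity #|[set i | p i]|.
    by apply: eq_card => i; rewrite !inE /p inE.
  rewrite -(card_perm_preim s p).
  by apply: eq_card => i; rewrite in_set /= /p sP [RHS]in_set.
have PE : exc_set s = pos_set w.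
  apply: exc_setE => // k; rewrite -nposE -nvalE -[X in _ <= X]add0n.
  by apply: okv; rewrite size_tuple.
split=> //; split=> //.
  move=> i j ij Pi.
  have := oks j; rewrite size_tuple ltn_ord => /(_ isT).
  by rewrite nth_pos_set ij /= nth_pos_set; apply.
apply/setP => j; rewrite -(permKV s j) mem_imset ?sP //; exact: perm_inj.
Qed.

Lemma word_permK w : word_ok 0 false w -> excedance_word (word_perm w) = w.
Proof.
move=> /word_perm_ok[exE [_ _ _ valE]]; apply: eq_from_tnth => i.
have := val_set_word (word_perm w); have := pos_set_word (word_perm w).
rewrite exE valE => /setP/(_ i) + /setP/(_ i); rewrite !inE.
by case: (tnth _ i) => p v; case: (tnth w i) => p' v' /= -> ->.
Qed.

Lemma word_perm_in_class w : word_ok 0 false w -> in_class (word_perm w).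
Proof.
by move=> /word_perm_ok[exE [incE incC sp _]]; apply/in_classP; rewrite exE.
Qed.

(** Reindexing leaves the words w that encode [word_perm w] in the class. Every other word fails
    [word_ok], hence has weight 0. *)
Lemma sum_in_class : (\sum_(s : 'S_n | avoids321 s && avoids3b142 s)
  y ^+ exc s * q ^+ cr s = suffix_sum 0 false n)%R.
Proof.
rewrite (reindex_onto word_perm excedance_word excedance_wordK).
rewrite big_mkcond; apply: eq_bigr => w _.
case: ifP => [/andP[cw /eqP wE]|nw].
  by rewrite -word_weight_excedance // wE.
rewrite word_weightE; case: ifP => // okw; move: nw.
by rewrite -/(in_class _) word_perm_in_class // word_permK // eqxx.
Qed.

End Encoding.

Local Open Scope ring_scope.

Theorem theorem4p4 :
  fps_cvg
    (contfrac (fun k => 1 - fpsC (q ^+ k) * t)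
              (fun k => fpsC (y * q ^+ k) * t ^+ 2) 0)
    gf_321_3b142.
Proof.
have := suffix_sum_cvg; congr fps_cvg; apply: fpsP => n.
exact/esym/sum_in_class.
Qed.
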